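(* Let $\{Q\}$ be a system of semiseparable polynomials, $\deg Q_k=k$, satisfying $$\begin{bmatrix}G_k(x)\\Q_k(x)\end{bmatrix}=\begin{bmatrix}\alpha_k&\beta_k\\ \gamma_k&1\end{bmatrix}\begin{bmatrix}G_{k-1}(x)\\(\delta_kx+\theta_k)Q_{k-1}(x)\end{bmatrix},\qquad k=1,\dots,n,$$ with auxiliary polynomials $G_k$, $G_0=Q_0$. Then the system of generalized associated polynomials $\widehat Q=\{\widehat Q_0(x),\dots,\widehat Q_{n-1}(x)\}$ is also semiseparable: there are auxiliary polynomials $\widehat G_0,\dots,\widehat G_{n-1}$ (with $\widehat G_0=\frac{\gamma_n}{\delta_n}\widehat Q_0$) such that $$\begin{bmatrix}\widehat G_k(x)\\\widehat Q_k(x)\end{bmatrix}=\begin{bmatrix}\widehat\alpha_k&\widehat\beta_k\\ \widehat\gamma_k&1\end{bmatrix}\begin{bmatrix}\widehat G_{k-1}(x)\\(\widehat\delta_kx+\widehat\theta_k)\widehat Q_{k-1}(x)\end{bmatrix},\qquad k=1,\dots,n-1,$$ where $$\widehat\alpha_k=\alpha_{n-k},\quad\widehat\beta_k=\frac{\gamma_{n-k}}{\delta_{n-k}},\quad\widehat\gamma_k=\beta_{n-k}\cdot\delta_{n-k},\quad\widehat\delta_k=\delta_{n-k},\quad\widehat\theta_k=\frac{\delta_{n-k}}{\delta_{n-k+1}}\theta_{n-k+1}.$$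
   Context: Generalized associated polynomials: let $Q_0,\dots,Q_n$ be complex polynomials with $\deg Q_k=k$, written as $Q_0(x)=\tau_0$ and $Q_k(x)=\tau_kx\,Q_{k-1}(x)-\sum_{j=0}^{k-1}a_{j,k}Q_j(x)$ for $k=1,\dots,n$ (so all $\tau_k\neq0$). The generalized associated (Horner) polynomials $\widehat Q_0,\dots,\widehat Q_{n-1}$ are defined by $$\widehat Q_0(x)=\widehat\tau_0,\qquad\widehat Q_k(x)=\widehat\tau_kx\,\widehat Q_{k-1}(x)-\sum_{j=0}^{k-1}\widehat a_{j,k}\widehat Q_j(x),\quad k=1,\dots,n-1,$$ $$\widehat\tau_k=\tau_{n-k}\ (k=0,\dots,n-1),\qquad\widehat a_{j,k}=\frac{\tau_{n-k}}{\tau_{n-j}}a_{n-k,n-j}\ (k=1,\dots,n-1,\ j=0,\dots,k-1).$$ A polynomial system is called semiseparable here if it satisfies a two-term recurrence of the displayed form. *)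

(* Defs.v *)
From HB Require Import structures.
From mathcomp Require Import all_boot all_order all_algebra.
From mathcomp Require Import reals complex.

Set Implicit Arguments.
Unset Strict Implicit.
Unset Printing Implicit Defensive.

Import GRing.Theory.
Local Open Scope ring_scope.

(* Systems of polynomials and their coefficients are indexed
   by [nat]; only the values at indices inside the stated ranges matter. *)

Definition has_degrees (F : fieldType) (n : nat) (Q : nat -> {poly F}) : Prop :=
  forall k : nat, (k <= n)%N -> size (Q k) = k.+1.

(* This determines Q_0, ..., Q_n from tau and a.  Conversely, when deg Q_k = k
   for all k <= n, it determines tau_k and a_{j,k} (j < k <= n) from Q. *)
Definition full_recurrence (F : fieldType) (n : nat)
    (tau : nat -> F) (a : nat -> nat -> F) (Q : nat -> {poly F}) : Prop :=
  Q 0%N = (tau 0%N)%:P /\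
  forall k : nat, (1 <= k <= n)%N ->
    Q k = tau k *: ('X * Q k.-1) - \sum_(j < k) a j k *: Q j.

Definition assoc_tau (F : fieldType) (n : nat) (tau : nat -> F) : nat -> F :=
  fun k => tau (n - k)%N.

Definition assoc_a (F : fieldType) (n : nat)
    (tau : nat -> F) (a : nat -> nat -> F) : nat -> nat -> F :=
  fun j k => tau (n - k)%N / tau (n - j)%N * a (n - k)%N (n - j)%N.

(* Qh 0, ..., Qh n.-1 are the generalized associated (Horner) polynomials of
   the system Q_0, ..., Q_n with recurrence coefficients tau and a. *)
Definition generalized_associated (F : fieldType) (n : nat)
    (tau : nat -> F) (a : nat -> nat -> F) (Qh : nat -> {poly F}) : Prop :=
  full_recurrence n.-1 (assoc_tau n tau) (assoc_a n tau a) Qh.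

(* Q_0, ..., Q_n is semiseparable with the given two-term recurrence
   coefficients and auxiliary polynomials G_0, ..., G_n.  The initial value
   G_0 is left out because it differs between a system and its associated
   system.  The 2 x 2 matrix is made of 1 x 1 blocks. *)
Definition semiseparable_with (F : fieldType) (n : nat)
    (alpha beta gamma delta theta : nat -> F) (G Q : nat -> {poly F}) : Prop :=
  forall k : nat, (1 <= k <= n)%N ->
    col_mx (G k)%:M (Q k)%:M =
    block_mx (alpha k)%:P%:M (beta k)%:P%:M
             (gamma k)%:P%:M 1%:M
    *m col_mx (G k.-1)%:M ((delta k *: 'X + (theta k)%:P) * Q k.-1)%:M
    :> 'cV[{poly F}]_(1 + 1).

(* Main.v *)
Require Import Defs.
From HB Require Import structures.
From mathcomp Require Import all_boot all_order all_algebra.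
From mathcomp Require Import reals complex.
From mathcomp Require Import zify ring.

(** Write p_i = alpha_i - beta_i gamma_i.  Eliminating the auxiliary
    polynomials from a two-term recurrence with G_0 = beta_0 Q_0 gives
    G_k = sum_(j <= k) beta_j p_(j+1) ... p_k Q_j, hence a full recurrence with
    leading coefficients delta_k and
      a_(j,k) = - (beta_j p_(j+1) ... p_(k-1) gamma_k + [j = k - 1] theta_k).
    The computation is reversible: a full recurrence with such coefficients
    comes from a two-term one.  So semiseparability is a property of the
    triangular array a ([semiseparable_full_recurrence] and
    [full_recurrence_semiseparable]).

    Since deg Q_k = k, the polynomials x Q_(k-1), Q_(k-1), ..., Q_0 are
    linearly independent, so the given tau and a must be the delta and the
    array above ([full_recurrence_unique]).

    The passage to the associated polynomials reflects the array in its
    antidiagonal, (j, k) |-> (n - k, n - j), and rescales it by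
    delta_(n-k) / delta_(n-j).  The reflection reverses the product of the p_i
    and exchanges the roles of the factor beta_j, indexed by the row j, and of
    the factor gamma_k, indexed by the column k, so the shape of the array is
    kept.  The rescaling turns the new row factor gamma_(n-j) into
    gamma_(n-j) / delta_(n-j) and the new column factor beta_(n-k) into
    beta_(n-k) delta_(n-k), so the products beta_i gamma_i in the p_i survive
    ([assoc_a_semiseparable]).  The row factor at j = 0 is gamma_n / delta_n,
    which is the initial value required of the new auxiliary polynomials. *)

Set Implicit Arguments.
Unset Strict Implicit.
Unset Printing Implicit Defensive.

Import GRing.Theory.
Local Open Scope ring_scope.

Lemma prod_nat_reflect (R : comNzRingType) (n a b : nat) (f : nat -> R) :
  (a <= b <= n)%N ->
  \prod_(a <= i < b) f (n - i)%N =
  \prod_((n - b).+1 <= i < (n - a).+1) f i.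
Proof.
elim: b => [|b IHb] /andP[le_ab le_bn].
  by rewrite !big_geq //; lia.
have [->|ne_ab] := eqVneq a b.+1; first by rewrite !big_geq.
rewrite big_nat_recr ?IHb /=; try lia.
have -> : (n - b.+1).+1 = (n - b)%N by lia.
by rewrite [RHS]big_ltn 1?mulrC //; lia.
Qed.

Section FieldCoefficients.

Variable F : fieldType.
Implicit Types (tau alpha beta gamma delta theta : nat -> F).
Implicit Types (a : nat -> nat -> F) (P Q G : nat -> {poly F}).

(** Polynomials whose degrees are 0, 1, ..., m - 1 are linearly independent:
    only the last one reaches the coefficient of degree m - 1. *)
Lemma graded_free (m : nat) (c : nat -> F) P :
  (forall j, (j < m)%N -> size (P j) = j.+1) ->
  \sum_(j < m) c j *: P j = 0 -> forall j, (j < m)%N -> c j = 0.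
Proof.
elim: m => [//|m IHm] szP sum0.
have szPm := szP m (ltnSn m).
have cm0 : c m = 0.
  move: (congr1 (fun p : {poly F} => p`_m) sum0).
  rewrite big_ord_recr coefD coef_sum big1 ?coef0 ?add0r => [|i _]; last first.
    have lt_im := ltn_ord i.
    by rewrite coefZ nth_default ?mulr0 //= szP // ltnW.
  move/eqP; rewrite coefZ mulf_eq0.
  have -> : (P m)`_m = lead_coef (P m) by rewrite lead_coefE szPm.
  by rewrite lead_coef_eq0 -size_poly_eq0 szPm orbF => /eqP.
move: sum0; rewrite big_ord_recr /= cm0 scale0r addr0 => sum0 j.
rewrite ltnS leq_eqVlt => /predU1P[-> //|lt_jm].
by apply: IHm lt_jm => // i lt_im; apply: szP; apply: ltnW.
Qed.

Lemma full_recurrence_unique n tau tau' a a' Q :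
  has_degrees n Q -> full_recurrence n tau a Q ->
  (forall k, (1 <= k <= n)%N ->
    Q k = tau' k *: ('X * Q k.-1) - \sum_(j < k) a' j k *: Q j) ->
  forall k, (1 <= k <= n)%N ->
    tau k = tau' k /\ forall j, (j < k)%N -> a j k = a' j k.
Proof.
move=> szQ [_ recQ] recQ' [//|k] kn.
(* The difference of the two recurrences is a linear relation between
   Q_0, ..., Q_k and x Q_k, whose degrees are 0, ..., k + 1. *)
pose c j := if (j < k.+1)%N then a' j k.+1 - a j k.+1
            else tau k.+1 - tau' k.+1.
pose P j := if (j < k.+1)%N then Q j else 'X * Q k.
have szP j : (j < k.+2)%N -> size (P j) = j.+1.
  rewrite /P; case: (ltnP j k.+1) => [lt_jk _|le_kj lt_jk].
    by apply: szQ; lia.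
  have -> : j = k.+1 by lia.
  have szQk : size (Q k) = k.+1 by apply: szQ; lia.
  by rewrite mulrC size_mulX ?szQk // -size_poly_eq0 szQk.
have sum0 : \sum_(j < k.+2) c j *: P j = 0.
  rewrite big_ord_recr /= {2}/c {2}/P ltnn.
  rewrite (eq_bigr (fun j : 'I_k.+1 => a' j k.+1 *: Q j - a j k.+1 *: Q j)).
    rewrite sumrB scalerBl.
    move: (recQ _ kn); rewrite (recQ' _ kn) /= => /eqP.
    rewrite -subr_eq0 => /eqP eqQ.
    by apply: oppr_inj; rewrite oppr0 -[RHS]eqQ; ring.
  by move=> j _; rewrite /c /P ltn_ord scalerBl.
have c0 := graded_free szP sum0; split.
  by have := c0 k.+1 (ltnSn _); rewrite /c ltnn => /subr0_eq.
by move=> j lt_jk; have := c0 j (ltnW lt_jk); rewrite /c lt_jk => /subr0_eq.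
Qed.

(** With tau_k = 0 the right-hand side would have degree at most k - 1. *)
Lemma full_recurrence_lead_neq0 n tau a Q :
  has_degrees n Q -> full_recurrence n tau a Q ->
  forall k, (1 <= k <= n)%N -> tau k != 0.
Proof.
move=> szQ [_ recQ] k kn; apply/eqP => tau0.
have /andP[_ le_kn] := kn; have := szQ k le_kn.
rewrite recQ // tau0 scale0r add0r size_polyN => szk.
suff : (size (\sum_(j < k) a j k *: Q j)%R <= k)%N by rewrite szk ltnn.
apply: (leq_trans (size_sum _ _ _)); apply/bigmax_leqP => j _.
apply: leq_trans (size_scale_leq _ _) _; rewrite szQ //.
by rewrite (leq_trans _ le_kn) // ltnW.
Qed.

(** The factor p_k that propagates G from one step to the next: replacing
    (delta_k x + theta_k) Q_(k-1) by Q_k - gamma_k G_(k-1) in the first line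
    of the recurrence gives G_k = p_k G_(k-1) + beta_k Q_k. *)
Definition transfer alpha beta gamma (k : nat) : F :=
  alpha k - beta k * gamma k.

Lemma semiseparable_withP n alpha beta gamma delta theta G Q :
  semiseparable_with n alpha beta gamma delta theta G Q <->
  forall k, (k < n)%N ->
    G k.+1 = transfer alpha beta gamma k.+1 *: G k + beta k.+1 *: Q k.+1 /\
    Q k.+1 = gamma k.+1 *: G k
             + (delta k.+1 *: 'X + (theta k.+1)%:P) * Q k.
Proof.
have scalar_block (p q u v w : {poly F}) :
    block_mx p%:M q%:M u%:M 1%:M *m col_mx v%:M w%:M =
    col_mx (p * v + q * w)%:M (u * v + w)%:M :> 'cV_(1 + 1).
  by rewrite mul_block_col -!scalar_mxM mul1r -!raddfD.
have two_step k : transfer alpha beta gamma k *: G k.-1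
      + beta k *: (gamma k *: G k.-1
                   + (delta k *: 'X + (theta k)%:P) * Q k.-1) =
    (alpha k)%:P * G k.-1
      + (beta k)%:P * ((delta k *: 'X + (theta k)%:P) * Q k.-1).
  by rewrite /transfer -!mul_polyC polyCB polyCM; ring.
split=> [ssQ k lt_kn | ssQ [//|k] lt_kn].
  have := ssQ k.+1 lt_kn; rewrite scalar_block => /eq_col_mx[eqG eqQ].
  move: (congr1 (fun A : 'M_1 => A 0 0) eqG) => {eqG}.
  move: (congr1 (fun A : 'M_1 => A 0 0) eqQ) => {eqQ}.
  rewrite !mxE !mulr1n mul_polyC => -> ->.
  by split=> //; rewrite (two_step k.+1).
have [-> ->] := ssQ k lt_kn.
by rewrite scalar_block (mul_polyC (gamma _)) (two_step k.+1).
Qed.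

Definition semiseparable_coef alpha beta gamma theta (j k : nat) : F :=
  - (beta j * \prod_(j.+1 <= i < k) transfer alpha beta gamma i * gamma k
     + (if j.+1 == k then theta k else 0)).

(** The solution of G_k = p_k G_(k-1) + beta_k Q_k with G_0 = beta_0 Q_0. *)
Definition aux_poly alpha beta gamma Q (k : nat) : {poly F} :=
  \sum_(j < k.+1)
    (beta j * \prod_(j.+1 <= i < k.+1) transfer alpha beta gamma i) *: Q j.

Lemma aux_poly0 alpha beta gamma Q :
  aux_poly alpha beta gamma Q 0 = beta 0%N *: Q 0%N.
Proof. by rewrite /aux_poly big_ord1 big_geq // mulr1. Qed.

Lemma aux_polyS alpha beta gamma Q k :
  aux_poly alpha beta gamma Q k.+1 =
  transfer alpha beta gamma k.+1 *: aux_poly alpha beta gamma Q k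
  + beta k.+1 *: Q k.+1.
Proof.
rewrite /aux_poly big_ord_recr /= [in X in _ + X]big_geq // mulr1.
congr (_ + _); rewrite scaler_sumr; apply: eq_bigr => j _.
by rewrite scalerA big_nat_recr //= ?ltnS 1?ltnW // mulrA mulrC.
Qed.

Lemma semiseparable_step alpha beta gamma delta theta Q k :
  gamma k.+1 *: aux_poly alpha beta gamma Q k
    + (delta k.+1 *: 'X + (theta k.+1)%:P) * Q k =
  delta k.+1 *: ('X * Q k)
    - \sum_(j < k.+1) semiseparable_coef alpha beta gamma theta j k.+1 *: Q j.
Proof.
rewrite big_ord_recr /= /semiseparable_coef eqxx big_geq // mulr1.
rewrite /aux_poly big_ord_recr /= big_geq // mulr1.
rewrite [in RHS](eq_bigr (fun j : 'I_k => - (gamma k.+1 *: ((beta j *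
    \prod_(j.+1 <= i < k.+1) transfer alpha beta gamma i) *: Q j)))).
  rewrite sumrN -scaler_sumr -!mul_polyC polyCN polyCD polyCM; ring.
by move=> j _; rewrite eqSS ltn_eqF // addr0 scaleNr scalerA (mulrC (gamma _)).
Qed.

(** The two-term recurrence starts at beta_1, so beta_0 is free to encode the
    initial value of G; then G_0 = beta_0 Q_0 is the instance k = 0 of
    G_k = p_k G_(k-1) + beta_k Q_k with G_(-1) = 0, and it needs no separate
    treatment in the coefficients. *)
Lemma semiseparable_full_recurrence n alpha beta gamma delta theta G Q :
  G 0%N = beta 0%N *: Q 0%N ->
  semiseparable_with n alpha beta gamma delta theta G Q ->
  forall k, (1 <= k <= n)%N ->
    Q k = delta k *: ('X * Q k.-1)
      - \sum_(j < k) semiseparable_coef alpha beta gamma theta j k *: Q j.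
Proof.
move=> G0 /semiseparable_withP ssQ.
have GE k : (k <= n)%N -> G k = aux_poly alpha beta gamma Q k.
  elim: k => [|k IHk] lt_kn; first by rewrite aux_poly0.
  by have [-> _] := ssQ k lt_kn; rewrite aux_polyS IHk // ltnW.
move=> [//|k] /= lt_kn; have [_ ->] := ssQ k lt_kn.
by rewrite GE 1?ltnW // semiseparable_step.
Qed.

Lemma full_recurrence_semiseparable n alpha beta gamma delta theta Q :
  (forall k, (1 <= k <= n)%N ->
    Q k = delta k *: ('X * Q k.-1)
      - \sum_(j < k) semiseparable_coef alpha beta gamma theta j k *: Q j) ->
  semiseparable_with n alpha beta gamma delta theta
    (aux_poly alpha beta gamma Q) Q.
Proof.
move=> recQ; apply/semiseparable_withP => k lt_kn.
by rewrite aux_polyS semiseparable_step; split=> //; apply: (recQ k.+1).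
Qed.

(** Antidiagonal reflection keeps the semiseparable shape.  The new p_i equals
    alpha_(n-i) - (gamma_(n-i) / delta_(n-i)) (beta_(n-i) delta_(n-i)), that is,
    the old p_(n-i); this is where delta must not vanish.  The subdiagonal is
    reflected onto itself, (k - 1, k) |-> (n - k, n - k + 1), so theta_(n-k+1)
    is only rescaled. *)
Lemma assoc_a_semiseparable n alpha beta gamma delta theta :
  (forall k, (1 <= k <= n)%N -> delta k != 0) ->
  forall j k, (j < k < n)%N ->
  assoc_a n delta (semiseparable_coef alpha beta gamma theta) j k =
  semiseparable_coef
    (fun k => alpha (n - k)%N)
    (fun k => gamma (n - k)%N / delta (n - k)%N)
    (fun k => beta (n - k)%N * delta (n - k)%N)
    (fun k => delta (n - k)%N / delta (n - k + 1)%N * theta (n - k + 1)%N) j k.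
Proof.
move=> delta_neq0 j k /andP[lt_jk lt_kn].
set ah := fun k => alpha (n - k)%N.
set bh := fun k => gamma (n - k)%N / delta (n - k)%N.
set gh := fun k => beta (n - k)%N * delta (n - k)%N.
have transferE i : (j.+1 <= i < k)%N ->
    transfer ah bh gh i = transfer alpha beta gamma (n - i).
  move=> ik; rewrite /transfer /ah /bh /gh.
  by have d0 : delta (n - i)%N != 0 by [apply: delta_neq0; lia]; field.
rewrite /semiseparable_coef /assoc_a (eq_big_nat _ _ transferE).
rewrite prod_nat_reflect; last by lia.
have -> : (n - j.+1).+1 = (n - j)%N by lia.
have -> : ((n - k).+1 == n - j)%N = (j.+1 == k) by lia.
rewrite /bh /gh; have dj0 : delta (n - j)%N != 0 by apply: delta_neq0; lia.
case: (j.+1 =P k) => [<-|_]; last by field.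
have -> : (n - j.+1 + 1 = n - j)%N by lia.
by field.
Qed.

End FieldCoefficients.

Theorem lemma4p2 (R : realType) (n : nat) (n_gt0 : (0 < n)%N)
    (tau : nat -> complex R) (a : nat -> nat -> complex R)
    (Q : nat -> {poly (complex R)})
    (degQ : has_degrees n Q)
    (recQ : full_recurrence n tau a Q)
    (alpha beta gamma delta theta : nat -> complex R)
    (G : nat -> {poly (complex R)})
    (G0 : G 0%N = Q 0%N)
    (ssQ : semiseparable_with n alpha beta gamma delta theta G Q)
    (Qh : nat -> {poly (complex R)})
    (assocQh : generalized_associated n tau a Qh) :
  exists Gh : nat -> {poly (complex R)},
    Gh 0%N = (gamma n / delta n) *: Qh 0%N /\
    semiseparable_with n.-1
      (fun k => alpha (n - k)%N)
      (fun k => gamma (n - k)%N / delta (n - k)%N)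
      (fun k => beta (n - k)%N * delta (n - k)%N)
      (fun k => delta (n - k)%N)
      (fun k => delta (n - k)%N / delta (n - k + 1)%N * theta (n - k + 1)%N)
      Gh Qh.
Proof.
(* G_0 = Q_0 means beta_0 = 1. *)
pose beta1 k := if k == 0%N then 1 else beta k.
have ssQ1 : semiseparable_with n alpha beta1 gamma delta theta G Q.
  by move=> [//|k] kn; apply: (ssQ k.+1 kn).
have GQ0 : G 0%N = beta1 0%N *: Q 0%N by rewrite scale1r.
have coefE := full_recurrence_unique degQ recQ
  (semiseparable_full_recurrence GQ0 ssQ1).
have delta_neq0 k : (1 <= k <= n)%N -> delta k != 0.
  by move=> kn; have [<- _] := coefE k kn;
    apply: full_recurrence_lead_neq0 degQ recQ _ kn.
have tau_delta k : (k < n)%N -> tau (n - k)%N = delta (n - k)%N.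
  by move=> lt_kn; have [|-> _] := coefE (n - k)%N; first lia.
have [_ recQh] := assocQh.
pose alphah k := alpha (n - k)%N.
pose betah k := gamma (n - k)%N / delta (n - k)%N.
pose gammah k := beta1 (n - k)%N * delta (n - k)%N.
exists (aux_poly alphah betah gammah Qh).
split; first by rewrite aux_poly0 /betah subn0.
have ssQh : semiseparable_with n.-1 alphah betah gammah
    (fun k => delta (n - k)%N)
    (fun k => delta (n - k)%N / delta (n - k + 1)%N * theta (n - k + 1)%N)
    (aux_poly alphah betah gammah Qh) Qh.
  apply: full_recurrence_semiseparable => k kn.
  rewrite recQh // /assoc_tau tau_delta; last by lia.
  congr (_ - _); apply: eq_bigr => j _; congr (_ *: _).
  have lt_jk := ltn_ord j.
  rewrite -(assoc_a_semiseparable _ _ _ _ delta_neq0) /assoc_a; last by lia.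
  rewrite !tau_delta; try lia.
  by have [|_ ->] := coefE (n - j)%N; first lia; last lia.
move=> k kn; have := ssQh k kn; rewrite /gammah /beta1.
by have /negPf -> : (n - k)%N != 0%N by lia.
Qed.
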